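(* Let $A\in\mathbb F^{n\times n}$ be invertible with $A^H=A$, and let the graph of $A$ have treewidth $\tau$. Then $A^{-1}$ has strict complementary rank $O(\tau)$.
   Context: $\mathbb F$ is an arbitrary field with a fixed involution $a\mapsto a^*$ (a field automorphism with $(a^* )^*=a$, possibly the identity); $(X^H)_{ij}=x_{ji}^*$. The graph of $A$ has vertex set $\{1,\dots,n\}$ and an edge $\{i,j\}$, $i\neq j$, whenever $a_{ij}\ne0$. Treewidth is the minimum over tree decompositions of the maximum bag size minus one. Strict complementary rank: a matrix $K\in\mathbb F^{n\times n}$ with $K^H=K$ has strict complementary rank $r$ if there exists a one-to-one mapping between the row/column indices $\{1,\dots,n\}$ (the vertices of the graph of $K$) and the nodes of a (rooted) binary tree, such that for any node $u$ of the tree, with $S$ the set of indices mapped to the subtree rooted at $u$ and $V$ the remaining indices, $\operatorname{rank}(K_{S,V})\le r$, where $K_{S,V}\in\mathbb F^{|S|\times|V|}$ is the submatrix of $K$ with rows $S$ and columns $V$. The $O(\tau)$ is with an absolute constant. *)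

(* Defs.v *)
From mathcomp Require Import all_boot all_order all_algebra.

Set Implicit Arguments.
Unset Strict Implicit.
Unset Printing Implicit Defensive.

Import GRing.Theory.
Local Open Scope ring_scope.

(* A graph on a finite vertex type is given by its adjacency relation. *)
Definition simple_graph (V : finType) (g : rel V) : Prop :=
  symmetric g /\ irreflexive g.

(* [ucycle e c] also holds of c = [:: x; y] for an edge xy (traversed back and
   forth), hence the bound 2: genuine cycles have at least three vertices. *)
Definition is_tree (T : finType) (e : rel T) : Prop :=
  [/\ simple_graph e,
      (0 < #|T|)%N,
      forall s t : T, connect e s t
    & forall c : seq T, ucycle e c -> (size c <= 2)%N].

Record tree_decomposition (V : finType) (g : rel V)
    (T : finType) (e : rel T) (B : T -> {set V}) : Prop := {
  td_tree : is_tree e;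
  td_vertex : forall v : V, exists t : T, v \in B t;
  td_edge : forall u v : V, g u v -> exists t : T, (u \in B t) && (v \in B t);
  td_connected : forall (v : V) (s t : T), v \in B s -> v \in B t ->
    connect [rel a b | [&& e a b, v \in B a & v \in B b]] s t }.

(* The predecessor truncates only when all bags are empty, i.e. when the graph
   has no vertex. *)
Definition td_width (V T : finType) (B : T -> {set V}) : nat :=
  (\max_(t : T) #|B t|).-1.

Definition has_treewidth (V : finType) (g : rel V) (w : nat) : Prop :=
  (exists (T : finType) (e : rel T) (B : T -> {set V}),
     tree_decomposition g e B /\ td_width B = w) /\
  (forall (T : finType) (e : rel T) (B : T -> {set V}),
     tree_decomposition g e B -> (w <= td_width B)%N).

Definition mx_graph (F : fieldType) (n : nat) (A : 'M[F]_n) : rel 'I_n :=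
  [rel i j | (i != j) && (A i j != 0)].

Definition hermitian_wrt (F : fieldType) (star : F -> F) (n : nat)
    (A : 'M[F]_n) : Prop :=
  map_mx star A^T = A.

(* Rooted binary trees (each node has at most two children) whose nodes carry
   labels; [BEmpty] stands for an absent subtree and is not a node. *)
Inductive bintree (L : Type) : Type :=
  | BEmpty
  | BNode of bintree L & L & bintree L.
Arguments BEmpty {L}.

Fixpoint labels (L : Type) (t : bintree L) : seq L :=
  if t is BNode l x r then labels l ++ x :: labels r else [::].

(* [u] is the subtree of [t] rooted at some node of [t]. *)
Fixpoint node_subtree (L : Type) (u t : bintree L) : Prop :=
  if t is BNode l x r then
    [\/ u = BNode l x r, node_subtree u l | node_subtree u r]
  else False.

(* The nodes of [t] are in bijection with [L] via their labels. *)
Definition bijective_labels (L : finType) (t : bintree L) : Prop :=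
  uniq (labels t) /\ forall x : L, x \in labels t.

Definition submx_of (F : fieldType) (m n : nat) (K : 'M[F]_(m, n))
    (S : {set 'I_m}) (V : {set 'I_n}) : 'M[F]_(#|S|, #|V|) :=
  mxsub (fun i : 'I_#|S| => enum_val i) (fun j : 'I_#|V| => enum_val j) K.

Definition strict_complementary_rank (F : fieldType) (star : F -> F) (n : nat)
    (K : 'M[F]_n) (r : nat) : Prop :=
  hermitian_wrt star K /\
  exists t : bintree 'I_n,
    bijective_labels t /\
    forall u : bintree 'I_n, node_subtree u t ->
      let S := [set i in labels u] in
      (\rank (submx_of K S (~: S)) <= r)%N.

(* Main.v *)
Require Import Defs.
From mathcomp Require Import all_boot all_order all_algebra.

(* Call S separated by a bag if every outside neighbour of S lies in that bag.
   A connected set S separated by a bag is also separated by some bag meeting S: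
   walk in the tree towards the subtree of bags that meet S and stop at its first
   node.  The binary tree on S arises by picking a connected component S1 of S
   and a vertex x of S1 in such a bag: x is the root, its children are built on
   S1 - x and S - S1, and every subtree is again separated by one bag.

   If D is the diagonal projector on S and K the inverse of A, then
   K (A D - D A) K = D K - K D agrees with K on the block S x ~S, while the
   nonzero entries of A D - D A are entries of A across the cut, covered by
   the rows and columns of a single bag. *)

Set Implicit Arguments.
Unset Strict Implicit.
Unset Printing Implicit Defensive.

Import GRing.Theory.
Local Open Scope ring_scope.

(** * Paths, and bridges in trees *)

Section Connectivity.

Variable T : finType.
Implicit Type e : rel T.

Lemma connect_exit e (W : {pred T}) x y :
    connect e x y -> x \in W -> y \notin W ->
  exists a b, [/\ e a b, a \in W & b \notin W].
Proof.
move=> /connectP[p ep ->]; elim: p x ep => [|z p IHp] x /=; first by move=> _ ->.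
move=> /andP[exz ep] xW lastW.
have [zW|zW] := boolP (z \in W); first exact: IHp ep zW lastW.
by exists x, z.
Qed.

Lemma sub_connect e e' : subrel e e' -> subrel (connect e) (connect e').
Proof. by move=> see'; apply: connect_sub => x y /see'; apply: connect1. Qed.

(** A duplicate-free detour from [a] to [b] closes up with the edge into a cycle. Acyclicity leaves
    it at most two vertices, so the detour would be the edge itself, or [a = b] would be a loop. *)
Lemma tree_edge_bridge e a b : is_tree e -> e a b ->
  ~ connect [rel x y | [&& e x y, (x, y) != (a, b) & (x, y) != (b, a)]] a b.
Proof.
move=> [[e_sym e_irr] _ _ acyclic] eab /connectP[p0 e'p0 Eb].
move: Eb; case/shortenP: e'p0 => p e'p Up _ Eb.
have ep : path e a p by apply: sub_path e'p => x y /= /and3P[].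
have /acyclic : ucycle e (a :: p).
  by rewrite /ucycle Up /= rcons_path ep -Eb e_sym eab.
case: p e'p Up Eb ep => [|c [|d p]] //=.
  by move=> _ _ ba; rewrite ba e_irr in eab.
by rewrite andbT => /and3P[_ /[swap] _ /[swap] _ /[swap] <-]; rewrite eqxx.
Qed.

End Connectivity.

(** * Sets separated by a single bag, and the binary tree *)

Section Separation.

Variables (V T : finType) (g : rel V) (e : rel T) (B : T -> {set V}).
Hypothesis dec : tree_decomposition g e B.
Implicit Types (S : {set V}) (t : T).

Let tree_e : is_tree e := td_tree dec.

Definition nbhd_in S S' := forall u v, u \in S -> v \notin S -> g u v -> v \in S'.

Definition meets S : {pred T} := [pred t | B t :&: S != set0].

Lemma meetsP S t : reflect (exists2 x, x \in B t & x \in S) (t \in meets S).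
Proof.
apply: (iffP (set0Pn _)) => [[x /setIP[]]|[x xB xS]]; exists x => //.
by rewrite inE xB.
Qed.

Lemma meets_bag_connect S v s t : v \in S -> v \in B s -> v \in B t ->
  connect [rel x y | [&& e x y, x \in meets S & y \in meets S]] s t.
Proof.
move=> vS vs vt; apply: sub_connect (td_connected dec vs vt) => x y /=.
move=> /and3P[-> vx vy] /=.
by apply/andP; split; apply/meetsP; exists v.
Qed.

(** Adjacent vertices share a bag, and the bags holding a given vertex are connected, so a path
    inside [S] lifts to a walk through bags meeting [S]. *)
Lemma meets_connect S x y s t :
    connect [rel a b | [&& g a b, a \in S & b \in S]] x y ->
    x \in S -> x \in B s -> y \in B t ->
  connect [rel a b | [&& e a b, a \in meets S & b \in meets S]] s t.
Proof.
move=> /connectP[p gp ->]; elim: p x s gp => [|z p IHp] x s /=.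
  by move=> _ xS xs xt; apply: meets_bag_connect xS xs xt.
move=> /andP[/and3P[gxz xS zS] gp] _ xs lt.
have [r /andP[xr zr]] := td_edge dec gxz.
exact: connect_trans (meets_bag_connect xS xs xr) (IHp _ _ gp zS zr lt).
Qed.

Lemma bag_of_component S t :
    S != set0 ->
    {in S &, forall x y, connect [rel a b | [&& g a b, a \in S & b \in S]] x y} ->
    nbhd_in S (B t) ->
  exists x t', [/\ x \in S, x \in B t' & nbhd_in S (B t')].
Proof.
move=> /set0Pn[x0 x0S] S_conn nbS.
have [e_graph _ e_conn _] := tree_e; have [e_sym _] := e_graph.
case: (boolP (t \in meets S)) => [/meetsP[x xt xS]|tU]; first by exists x, t.
pose eU := [rel a b | [&& e a b, a \notin meets S & b \notin meets S]].
have eU_sym : symmetric eU by move=> a b /=; rewrite e_sym [X in _ && X]andbC.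
have [s0 x0s0] := td_vertex dec x0.
have s0U : s0 \in meets S by apply/meetsP; exists x0.
have eU_out a : connect eU t a -> a \notin meets S.
  move=> ta; apply/negP => aU.
  have [|b [c [/and3P[_ _ cU]]]] := connect_exit (W := [predC meets S]) ta tU.
    by rewrite inE negbK.
  by rewrite !inE cU.
(* The walk from [t] to [s0] must leave the set of nodes reachable through bags missing [S]. It does
   so along an edge [a b] whose end [b] is the first bag that meets [S]. *)
have [||a [b [eab ta bW]]] := connect_exit (W := [pred x | connect eU t x]) (e_conn t s0).
- by rewrite inE connect0.
- by rewrite inE; apply/negP => /eU_out; rewrite s0U.
rewrite inE in ta; have aU := eU_out _ ta.
have bU : b \in meets S.
  apply: contraNT bW => bU; rewrite inE (connect_trans ta) // connect1 //=.
  by rewrite eab aU.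
have [x xb xS] := meetsP _ _ bU.
exists x, b; split=> // u v uS vS guv; apply/negPn/negP => vb.
have vt := nbS _ _ uS vS guv.
have [s /andP[us vs]] := td_edge dec guv.
(* If [v] were not in [B b], the walk from [a] to [t] to [s] to [b] would bypass the edge [a b]. Its
   first piece avoids [b], whose bag meets [S]; the second avoids [b], as its bags contain [v]; the
   third avoids [a], as its bags meet [S]. *)
apply: (tree_edge_bridge tree_e eab).
apply: (@connect_trans _ _ t); last apply: (@connect_trans _ _ s).
- move: ta; rewrite (sym_connect_sym eU_sym).
  apply: sub_connect => y z /= /and3P[-> yU zU] /=; rewrite !xpair_eqE.
  apply/andP; split; first by apply: contraNN zU => /andP[_ /eqP->].
  by apply: contraNN yU => /andP[/eqP->].
- apply: sub_connect (td_connected dec vt vs) => y z /= /and3P[-> vy vz] /=.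
  rewrite !xpair_eqE; apply/andP; split; first by apply: contraNN vb => /andP[_ /eqP<-].
  by apply: contraNN vb => /andP[/eqP<-].
- apply: sub_connect (meets_connect (S_conn _ _ uS xS) uS us xb) => y z /=.
  move=> /and3P[-> yU zU] /=; rewrite !xpair_eqE.
  apply/andP; split; first by apply: contraNN aU => /andP[/eqP<-].
  by apply: contraNN aU => /andP[_ /eqP<-].
Qed.

Hypothesis g_sym : symmetric g.

Lemma separated_bintree S t : nbhd_in S (B t) ->
  exists bt : bintree V,
    [/\ uniq (labels bt), labels bt =i S
      & forall u, node_subtree u bt -> exists t', nbhd_in [set i in labels u] (B t')].
Proof.
have [m] := ubnP #|S|; elim: m S t => // m IHm S t; rewrite ltnS => leSm nbS.
have [->|/set0Pn[x0 x0S]] := eqVneq S set0.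
  by exists BEmpty; split=> // x; rewrite inE.
pose gS := [rel a b | [&& g a b, a \in S & b \in S]].
have gS_sym : symmetric gS by move=> a b /=; rewrite g_sym [X in _ && X]andbC.
pose S1 := [set y | connect gS x0 y]; pose S2 := S :\: S1.
have x0S1 : x0 \in S1 by rewrite inE connect0.
have S1S : S1 \subset S.
  apply/subsetP => y; rewrite inE => x0y; apply: contraTT x0S => yS.
  apply/negP => x0S; have [a [b [/and3P[_ _ bS] _]]] := connect_exit x0y x0S yS.
  by rewrite bS.
have S1_step u v : u \in S1 -> v \in S -> g u v -> v \in S1.
  move=> uS1 vS guv; have uS := subsetP S1S _ uS1; move: uS1; rewrite !inE => x0u.
  by apply: connect_trans x0u (connect1 _); rewrite /= guv uS.
(* No edge of [g] joins [S1] to [S2], so both inherit the separating bag of [S]. *)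
have nbS1 : nbhd_in S1 (B t).
  move=> u v uS1 vS1 guv; apply: (nbS u v) => //; first exact: (subsetP S1S).
  by apply: contraNN vS1 => vS; apply: S1_step guv.
have nbS2 : nbhd_in S2 (B t).
  move=> u v /setDP[uS uS1] vS2 guv; apply: (nbS u v) => //.
  apply: contraNN vS2 => vS; rewrite inE vS andbT; apply: contraNN uS1 => vS1.
  by apply: S1_step vS1 uS _; rewrite g_sym.
have S1_conn : {in S1 &, forall x y,
    connect [rel a b | [&& g a b, a \in S1 & b \in S1]] x y}.
  have from_x0 y : y \in S1 -> connect [rel a b | [&& g a b, a \in S1 & b \in S1]] x0 y.
    rewrite inE => /connectP[p gp ->] {y}.
    elim: p (x0) x0S1 gp => [|z p IHp] x xS1 /=; first by rewrite connect0.
    move=> /andP[/and3P[gxz _ zS] gp]; have zS1 := S1_step _ _ xS1 zS gxz.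
    by apply: connect_trans (connect1 _) (IHp z zS1 gp); rewrite /= gxz xS1.
  move=> x y /from_x0 x0x /from_x0; apply: connect_trans.
  by rewrite sym_connect_sym // => a b /=; rewrite g_sym [X in _ && X]andbC.
have [|x [t' [xS1 xt' nbS1']]] := bag_of_component _ S1_conn nbS1.
  by apply/set0Pn; exists x0.
have xS := subsetP S1S _ xS1.
(* Removing [x] from [S1] can add only [x] to the outside neighbours, and [x] lies in [B t']. *)
have [||l [Ul El nb_l]] := IHm (S1 :\ x) t'.
- by apply: leq_trans leSm; apply: proper_card (proper_sub_trans (properD1 xS1) S1S).
- move=> u v /setD1P[_ uS1] vS1x guv; have [<-//|xv] := eqVneq x v.
  apply: (nbS1' u v) => //; apply: contraNN vS1x => vS1.
  by rewrite in_setD1 eq_sym xv.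
have [||r [Ur Er nb_r]] := IHm S2 t => //.
- apply: leq_trans leSm; apply: proper_card; apply/properP; split; first exact: subsetDl.
  by exists x => //; rewrite inE xS1.
have Et : labels (BNode l x r) =i S.
  move=> y; rewrite mem_cat in_cons El Er !in_setD in_set1.
  have [->|_] /= := eqVneq y x; first by rewrite xS.
  by case: (boolP (y \in S1)) => //= /(subsetP S1S) ->.
exists (BNode l x r); split=> //.
- rewrite /= cat_uniq /= Ul Ur Er El !in_setD in_set1 xS1 eqxx /= andbT.
  apply/hasPn => y; rewrite Er => /setDP[_ yS1]; rewrite /= El.
  by apply: contraNN yS1 => /setD1P[].
- move=> u [->|/nb_l//|/nb_r//]; exists t.
  suff -> : [set i in labels (BNode l x r)] = S by [].
  by apply/setP => y; rewrite inE Et.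
Qed.

End Separation.

(** * Rank bounds from the support of a matrix *)

Section Rank.

Variable F : fieldType.

Lemma mxrank_mxsub m n m' n' (f : 'I_m' -> 'I_m) (g : 'I_n' -> 'I_n) (A : 'M[F]_(m, n)) :
  (\rank (mxsub f g A) <= \rank A)%N.
Proof.
rewrite -{1}[A]mulmx1 mxsub_mul -{1}[A]mul1mx mxsub_mul mxsub_id.
exact: leq_trans (mxrankM_maxl _ _) (mxrankM_maxr _ _).
Qed.

Lemma mxrank_row_support m n (M : 'M[F]_(m, n)) (B : {set 'I_m}) :
  (forall i j, M i j != 0 -> i \in B) -> (\rank M <= #|B|)%N.
Proof.
move=> supp; pose f (k : 'I_#|B|) : 'I_m := enum_val k.
(* Keeping only the rows in [B] and then putting them back in place recovers [M], which thus factors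
   through dimension [#|B|]. *)
suff -> : M = colsub f 1%:M *m rowsub f M by apply: mulmx_max_rank.
apply/matrixP => i j; rewrite mxE.
under eq_bigr do rewrite !mxE.
rewrite -(big_enum_val (A := mem B) (fun k => (i == k)%:R * M k j)) /=.
have [iB|iB] := boolP (i \in B).
  rewrite (bigD1 i) //= eqxx mul1r big1 ?addr0 // => k /andP[_ /negPf ki].
  by rewrite eq_sym ki mul0r.
rewrite big1 => [|k kB]; first by apply/eqP; apply: contraNT iB => /supp.
by have [ik|_] := eqVneq i k; [rewrite ik kB in iB | rewrite mul0r].
Qed.

(** The rows of [M] in [B] form one summand; what remains is supported on the columns in [B]. *)
Lemma mxrank_cover n (M : 'M[F]_n) (B : {set 'I_n}) :
  (forall i j, M i j != 0 -> (i \in B) || (j \in B)) -> (\rank M <= #|B| + #|B|)%N.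
Proof.
move=> supp; pose N := \matrix_(i, j) (if i \in B then M i j else 0).
rewrite -[M](subrK N) addrC; apply: leq_trans (mxrank_add _ _) (leq_add _ _).
  by apply: mxrank_row_support => i j; rewrite mxE; case: ifP => //; rewrite eqxx.
rewrite -mxrank_tr; apply: mxrank_row_support => i j; rewrite !mxE.
by case: ifPn => [_|/negPf jB]; rewrite ?subrr ?eqxx // subr0 => /supp; rewrite jB.
Qed.

Lemma mxrank_invmx_complement n (A : 'M[F]_n) (S B : {set 'I_n}) :
    A \in unitmx ->
    (forall i j, A i j != 0 -> (i \in S) != (j \in S) -> (i \in B) || (j \in B)) ->
  (\rank (submx_of (invmx A) S (~: S)) <= #|B| + #|B|)%N.
Proof.
move=> unitA cut; set K := invmx A.
pose D : 'M[F]_n := diag_mx (\row_i (i \in S)%:R).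
have -> : submx_of K S (~: S) =
    mxsub (fun i : 'I_#|S| => enum_val i) (fun j : 'I_#|~: S| => enum_val j)
      (K *m (A *m D - D *m A) *m K).
  rewrite mulmxBr mulmxBl !mulmxA mulVmx // mul1mx -!mulmxA mulmxV // mulmx1.
  apply/matrixP => i j; rewrite mul_diag_mx mul_mx_diag !mxE enum_valP.
  have := enum_valP j; rewrite inE => /negPf ->.
  by rewrite mul1r mulr0 subr0.
apply: leq_trans (mxrank_mxsub _ _ _) _.
apply: leq_trans (mxrankM_maxl _ _) _; apply: leq_trans (mxrankM_maxr _ _) _.
(* Entry [(i, j)] of the commutator is [A i j] times the difference of the indicators of [S] at [j]
   and [i], hence zero off the cut. *)
apply: mxrank_cover => i j; rewrite mul_diag_mx mul_mx_diag !mxE.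
rewrite [_ * A i j]mulrC -mulrBr mulf_eq0 negb_or => /andP[Aij SiSj]; apply: cut => //.
by apply: contraNN SiSj => /eqP->; rewrite subrr.
Qed.

End Rank.

(** * Hermitian symmetry and the final bound *)

Lemma hermitian_invmx (F : fieldType) (star : {rmorphism F -> F}) n (A : 'M[F]_n) :
  hermitian_wrt star A -> hermitian_wrt star (invmx A).
Proof. by rewrite /hermitian_wrt trmx_inv map_invmx => ->. Qed.

Lemma mx_graph_sym (F : fieldType) (star : {rmorphism F -> F}) n (A : 'M[F]_n) :
  hermitian_wrt star A -> symmetric (mx_graph A).
Proof. by move=> hA i j; rewrite /mx_graph /= eq_sym -{1}hA !mxE fmorph_eq0. Qed.

Theorem theorem6p2 :
  exists C : nat,
    forall (F : fieldType) (star : {rmorphism F -> F}) (n : nat)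
           (A : 'M[F]_n) (tau : nat),
      involutive star ->
      A \in unitmx ->
      hermitian_wrt star A ->
      has_treewidth (mx_graph A) tau ->
      strict_complementary_rank star (invmx A) (C * tau)%N.
Proof.
(* Bags of size at most [tau + 1] give rank at most [2 (tau + 1)], which is at most [4 tau] once
   [tau] is positive. *)
exists 4%N => F star n A tau _ unitA hA [[T [e [B [dec width]]]] _].
split; first exact: hermitian_invmx.
have [_ /card_gt0P[t _] _ _] := td_tree dec.
have g_sym := mx_graph_sym hA.
(* The full vertex set has no outside neighbours, so any bag separates it. *)
have [|bt [Ubt Ebt nb]] := separated_bintree dec g_sym (S := setT) (t := t).
  by move=> u v _; rewrite inE.
exists bt; split; first by split=> // x; rewrite Ebt inE.
move=> u /nb[s nbs] /=; set S := [set i in labels u].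
have bag r : (#|B r| <= tau.+1)%N.
  apply: leq_trans (leq_bigmax (F := fun r => #|B r|) r) _.
  by rewrite -width; apply: leqSpred.
have cut i j : A i j != 0 -> (i \in S) != (j \in S) -> (i \in B s) || (j \in B s).
  move=> Aij SiSj; have gij : mx_graph A i j.
    by rewrite /mx_graph /= Aij andbT; apply: contraNN SiSj => /eqP->.
  case: (boolP (i \in S)) SiSj => iS.
    by case: (boolP (j \in S)) => // jS _; rewrite (nbs i j) ?orbT.
  by case: (boolP (j \in S)) => // jS _; rewrite (nbs j i) // g_sym.
(* For [tau = 0] the bound [2 (tau + 1)] is too weak. Bags then have at most one vertex, so the
   graph has no edge, no entry of [A] crosses the cut, and the empty cover gives rank 0. *)
case: tau width bag => [|tau] _ bag.
  have := @mxrank_invmx_complement _ _ A S set0 unitA.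
  rewrite cards0 addn0 muln0; apply=> i j Aij SiSj.
  have ij : i != j by apply: contraNN SiSj => /eqP->.
  have [|r /andP[ir jr]] := td_edge dec (u := i) (v := j).
    by rewrite /mx_graph /= ij.
  have /card_le1_eqP ij_eq := bag r.
  by rewrite (ij_eq i j) ?eqxx in ij.
apply: leq_trans (mxrank_invmx_complement unitA cut) _.
apply: leq_trans (leq_add (bag s) (bag s)) _.
by rewrite addnn -mul2n !mulnS addnA leq_add // leq_mul2r orbT.
Qed.
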